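(* For an $\mathscr L$-class $L$ of a semigroup $S$, the following are equivalent: (i) the left $S$-act ${}^S\overline{L}/\mathscr H_{\overline{L}}$ is congruence-free; (ii) $\mathscr H_{\overline{L}}$ is the unique maximal congruence of ${}^S\overline{L}$; (iii) for all $x,y\in L$ with $(x,y)\notin\mathscr H$ there exists $s\in S$ such that precisely one of $sx$ or $sy$ belongs to $L$. When these conditions hold we have $\mathrm{Cong}({}^S\overline{L})=[\Delta_{\overline{L}},\mathscr H_{\overline{L}}]\cup\{\nabla_{\overline{L}}\}\cong \mathrm{Sub}(\Gamma)^\top$, and hence \[ \mathrm{Ht}(\mathrm{Cong}({}^S\overline{L}))= \mathrm{Ht}(\mathrm{Sub}(\Gamma))+1, \] where $\Gamma$ is the Schützenberger group of any $\mathscr H$-class in $L$.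
   Context: The height $\mathrm{Ht}(P)$ of a poset $P$ is the supremum of the cardinalities of chains in $P$. For a poset $P$, $P^\top$ is $P$ with a new top element adjoined. For a semigroup $S$, $S^1$ is $S$ if $S$ is a monoid and otherwise $S$ with an identity adjoined. Green's relations: $x\mathrel{\mathscr L}y\Leftrightarrow S^1x=S^1y$, $x\mathrel{\mathscr R}y\Leftrightarrow xS^1=yS^1$, $\mathscr H=\mathscr L\cap\mathscr R$. A left $S$-act is a set $A$ with maps $a\mapsto s\cdot a$ ($s\in S$) satisfying $s\cdot(s'\cdot a)=(ss')\cdot a$; a congruence of $A$ is an equivalence relation $\sigma$ on $A$ such that $(a,b)\in\sigma$ implies $(s\cdot a,s\cdot b)\in\sigma$ for all $s\in S$; $\mathrm{Cong}(A)$ is the lattice of congruences, with bottom $\Delta_A$ (equality) and top $\nabla_A=A\times A$. $A$ is congruence-free if its only congruences are $\Delta_A$ and $\nabla_A$. A congruence $\sigma$ is maximal if $\sigma\ne\nabla_A$ and there is no congruence $\tau$ with $\sigma\subsetneq\tau\subsetneq\nabla_A$. For an $\mathscr L$-class $L$, ${}^S\overline L$ is the left $S$-act with underlying set $\overline L=L\cup\{0\}$ ($0\notin S$ a new symbol) and action $s\cdot x=sx$ if $x,sx\in L$, and $s\cdot x=0$ otherwise. $\mathscr H_{\overline L}=\mathscr H{\restriction}_L\cup\{(0,0)\}$, which is a congruence of ${}^S\overline L$; $[\Delta_{\overline L},\mathscr H_{\overline L}]$ is the interval in $\mathrm{Cong}({}^S\overline L)$. The (right) Schützenberger group of an $\mathscr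 H$-class $H$ is the group, under composition, of all maps $\rho_t:H\to H$, $x\mapsto xt$, where $t\in S^1$ satisfies $Ht\subseteq H$; up to isomorphism it is the same for all $\mathscr H$-classes in one $\mathscr D$-class (where $\mathscr D=\mathscr L\vee\mathscr R$), in particular for all $\mathscr H$-classes in $L$. $\mathrm{Sub}(\Gamma)$ is the lattice of subgroups of $\Gamma$. *)

(* Defs.v *)
From HB Require Import structures.
From mathcomp Require Import all_boot all_order.
From mathcomp Require Import all_classical.

Set Implicit Arguments.
Unset Strict Implicit.
Unset Printing Implicit Defensive.

Import Order.TTheory.
Local Open Scope group_scope.
Local Open Scope classical_set_scope.
Local Open Scope quotient_scope.
Local Open Scope card_scope.

Section Green.
Variable S : semigroupType.
Implicit Types (x y : S) (t : option S).

Definition has_identity := exists e : S, forall x, e * x = x /\ x * e = x.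

(* S^1 as a subset of option S; None is the adjoined identity, present only
   when S has no identity of its own. *)
Definition S1 : set (option S) := [set t | t = None -> ~ has_identity].

Definition lmul1 t x := if t is Some s then s * x else x.
Definition rmul1 x t := if t is Some s then x * s else x.

Definition lideal x : set S := [set lmul1 t x | t in S1].
Definition rideal x : set S := [set rmul1 x t | t in S1].

Definition greenL x y := lideal x = lideal y.
Definition greenR x y := rideal x = rideal y.
Definition greenH x y := greenL x y /\ greenR x y.

Definition is_Lclass (L : set S) := exists x, L = [set y | greenL x y].
Definition is_Hclass (H : set S) := exists x, H = [set y | greenH x y].

Lemma lmul1_rmul1 t x u : rmul1 (lmul1 t x) u = lmul1 t (rmul1 x u).
Proof. by case: t u => [s|] [u|] //=; rewrite mulgA. Qed.

Lemma lidealP x y : lideal x y <-> y = x \/ exists s, y = s * x.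
Proof.
split=> [[[s|] _ <-]|[->|[s ->]]]; [by right; exists s|by left| |by exists (Some s)].
have [[e eP]|nid] := pselect has_identity; last by exists None.
by exists (Some e) => //=; case: (eP x).
Qed.

Lemma ridealP x y : rideal x y <-> y = x \/ exists s, y = x * s.
Proof.
split=> [[[s|] _ <-]|[->|[s ->]]]; [by right; exists s|by left| |by exists (Some s)].
have [[e eP]|nid] := pselect has_identity; last by exists None.
by exists (Some e) => //=; case: (eP x).
Qed.

Lemma lideal_refl x : lideal x x. Proof. by apply/lidealP; left. Qed.

Lemma rideal_refl x : rideal x x. Proof. by apply/ridealP; left. Qed.

Lemma lideal_sub x y : lideal x y -> lideal y `<=` lideal x.
Proof.
move=> /lidealP xy z /lidealP yz; apply/lidealP.
case: xy yz => [->//|[s ->]] [->|[t ->]]; right; first by exists s.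
by exists (t * s); rewrite mulgA.
Qed.

Lemma rideal_sub x y : rideal x y -> rideal y `<=` rideal x.
Proof.
move=> /ridealP xy z /ridealP yz; apply/ridealP.
case: xy yz => [->//|[s ->]] [->|[t ->]]; right; first by exists s.
by exists (s * t); rewrite mulgA.
Qed.

Lemma lideal_mul x s : lideal x (s * x).
Proof. by apply/lidealP; right; exists s. Qed.

Lemma rideal_mul x s : rideal x (x * s).
Proof. by apply/ridealP; right; exists s. Qed.

Lemma rideal_rmul1 x t : rideal x (rmul1 x t).
Proof. by case: t => [t|] /=; [exact: rideal_mul|exact: rideal_refl]. Qed.

Lemma greenLP x y : greenL x y <-> lideal x y /\ lideal y x.
Proof.
split=> [xy|[xy yx]]; last by apply/seteqP; split; exact: lideal_sub.
by split; [rewrite xy|rewrite -xy]; exact: lideal_refl.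
Qed.

Lemma greenRP x y : greenR x y <-> rideal x y /\ rideal y x.
Proof.
split=> [xy|[xy yx]]; last by apply/seteqP; split; exact: rideal_sub.
by split; [rewrite xy|rewrite -xy]; exact: rideal_refl.
Qed.

Lemma lideal_mulr x y t : lideal x y -> lideal (rmul1 x t) (rmul1 y t).
Proof.
case: t => [t|] //= /lidealP[->|[s ->]]; first exact: lideal_refl.
by rewrite -mulgA; exact: lideal_mul.
Qed.

Lemma rideal_mull x y s : rideal x y -> rideal (s * x) (s * y).
Proof.
move=> /ridealP[->|[t ->]]; first exact: rideal_refl.
by rewrite mulgA; exact: rideal_mul.
Qed.

Lemma greenL_mulr x y t : greenL x y -> greenL (rmul1 x t) (rmul1 y t).
Proof. by move=> /greenLP[xy yx]; apply/greenLP; split; exact: lideal_mulr. Qed.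

Lemma greenR_mull x y s : greenR x y -> greenR (s * x) (s * y).
Proof. by move=> /greenRP[xy yx]; apply/greenRP; split; exact: rideal_mull. Qed.

Lemma greenH_sym x y : greenH x y -> greenH y x.
Proof. by case. Qed.

Lemma greenH_trans x y z : greenH x y -> greenH y z -> greenH x z.
Proof. by move=> [xy xy'] [yz yz']; split; [exact: etrans yz|exact: etrans yz']. Qed.

Lemma greenL_in (L : set S) x y : is_Lclass L -> L x -> (L y <-> greenL x y).
Proof.
move=> [a ->] /= ax; split=> [ay|xy]; last exact: etrans xy.
by rewrite /greenL -ax.
Qed.

Lemma greenH_in (H : set S) x y : is_Hclass H -> H x -> (H y <-> greenH x y).
Proof.
move=> [a ->] /= ax; split=> [ay|xy]; last exact: greenH_trans xy.
exact: greenH_trans (greenH_sym ax) ay.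
Qed.

Lemma Lclass_mid (L : set S) x s s' : is_Lclass L ->
  L x -> L (s * s' * x) -> L (s' * x).
Proof.
move=> hL Lx /(greenL_in _ hL Lx)/greenLP[_ h].
apply/(greenL_in _ hL Lx)/greenLP.
split; first exact: lideal_mul.
by apply: lideal_sub h; rewrite -mulgA; exact: lideal_mul.
Qed.

Lemma greenH_mull (L : set S) x y s : is_Lclass L -> L x -> greenH x y -> L (s * x) ->
  L (s * y) /\ greenH (s * x) (s * y).
Proof.
move=> hL Lx [xyL xyR] Lsx; have xsxL := (greenL_in _ hL Lx).1 Lsx.
have sxyR := greenR_mull s xyR.
have sxyL : greenL (s * x) (s * y).
  have [t _ yE] := ((greenRP x y).1 xyR).1.
  have := greenL_mulr t xsxL.
  have -> : rmul1 (s * x) t = s * rmul1 x t by case: (t) => //= u; rewrite mulgA.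
  by rewrite yE /greenL => <-; rewrite -xsxL.
by split=> //; apply/(greenL_in _ hL Lsx).
Qed.

End Green.

Record lact (S : semigroupType) := LAct {
  lact_sort :> choiceType;
  lact_op : S -> lact_sort -> lact_sort;
  lact_opA : forall s s' a, lact_op s (lact_op s' a) = lact_op (s * s') a }.

Record is_congruence S (A : lact S) (r : set (A * A)) : Prop := IsCongruence {
  cong_refl : forall a, r (a, a);
  cong_sym : forall a b, r (a, b) -> r (b, a);
  cong_trans : forall b a c, r (a, b) -> r (b, c) -> r (a, c);
  cong_op : forall s a b, r (a, b) -> r (lact_op s a, lact_op s b) }.

(* The order is inclusion, inherited from set (A * A). *)
Definition Cong S (A : lact S) : Type := set_type (@is_congruence S A).
HB.instance Definition _ S (A : lact S) := SubChoice.on (Cong A).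
HB.instance Definition _ S (A : lact S) :=
  [SubChoice_isSubPOrder of Cong A by <: with set_display].

Definition cong_rel S (A : lact S) (r : Cong A) : set (A * A) := val r.

Lemma congP S (A : lact S) (r : Cong A) : is_congruence (cong_rel r).
Proof. exact: set_mem (valP r). Qed.

Definition MkCong S (A : lact S) (r : set (A * A)) (rP : is_congruence r) :
  Cong A := SigSub (mem_set rP).

Lemma cong_bot_subproof S (A : lact S) :
  is_congruence [set p : A * A | p.1 = p.2].
Proof. by split=> //= [b a c -> ->|s a b ->]. Qed.
Definition cong_bot S (A : lact S) : Cong A := MkCong (cong_bot_subproof A).

Lemma cong_top_subproof S (A : lact S) : is_congruence [set: A * A].
Proof. by []. Qed.
Definition cong_top S (A : lact S) : Cong A := MkCong (cong_top_subproof A).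

Definition congruence_free S (A : lact S) :=
  forall r : Cong A, r = cong_bot A \/ r = cong_top A.

Definition maximal_cong S (A : lact S) (r : Cong A) :=
  r <> cong_top A /\ ~ exists t : Cong A, (r < t < cong_top A)%O.

Section QuotientAct.
Variables (S : semigroupType) (A : lact S) (r : Cong A).

Definition cong_equiv : rel A := fun a b => `[< cong_rel r (a, b) >].

Lemma cong_equiv_refl : reflexive cong_equiv.
Proof. by move=> a; apply/asboolP; exact: cong_refl (congP r) a. Qed.

Lemma cong_equiv_sym : symmetric cong_equiv.
Proof.
by move=> a b; apply/asboolP/asboolP; exact: cong_sym (congP r) _ _.
Qed.

Lemma cong_equiv_trans : transitive cong_equiv.
Proof.
move=> b a c /asboolP ab /asboolP bc; apply/asboolP.
exact: (cong_trans (congP r)) ab bc.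
Qed.

Definition cong_equiv_rel :=
  EquivRel cong_equiv cong_equiv_refl cong_equiv_sym cong_equiv_trans.

Local Notation Q := {eq_quot cong_equiv_rel}.

Definition quot_op (s : S) (X : Q) : Q := \pi_Q (lact_op s (repr X)).

Lemma quot_op_pi s a : quot_op s (\pi_Q a) = \pi_Q (lact_op s a).
Proof.
apply/eqmodP/asboolP/(cong_op (congP r)).
have /eqmodP/asboolP := reprK (\pi_Q a); exact.
Qed.

Lemma quot_opA s s' X : quot_op s (quot_op s' X) = quot_op (s * s') X.
Proof. by rewrite -[X]reprK !quot_op_pi lact_opA reprK. Qed.

Definition quot_act : lact S := LAct quot_opA.

End QuotientAct.

Section LclassAct.
Variables (S : semigroupType) (L : set S) (hL : is_Lclass L).

(* None is the new symbol 0; insub lands in None exactly when s x is not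
   in L. *)
Definition Lbar_op (s : S) (x : option L) : option L :=
  obind (fun x : L => insub (s * val x)) x.

Lemma Lbar_opA s s' x : Lbar_op s (Lbar_op s' x) = Lbar_op (s * s') x.
Proof.
case: x => //= x; rewrite /Lbar_op/=; case: insubP => /= [y _ ->|s'xN].
  by rewrite mulgA.
rewrite insubN//; apply: contra s'xN => /set_mem h; apply/mem_set.
exact: Lclass_mid hL (set_mem (valP x)) h.
Qed.

Definition Lbar : lact S := LAct Lbar_opA.

Definition Hbar_set : set (Lbar * Lbar) := [set p |
  match p with
  | (Some x, Some y) => greenH (val x) (val y)
  | (None, None) => True
  | _ => False
  end].

Lemma Hbar_subproof : is_congruence Hbar_set.
Proof.
split.
- by case.
- by move=> [x|] [y|] //=; exact: greenH_sym.
- by move=> [y|] [x|] [z|] //=; exact: greenH_trans.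
- move=> s [x|] [y|] //= xy; rewrite /Lbar_op/=.
  have Lx := set_mem (valP x); have Ly := set_mem (valP y).
  case: insubP => [x' /set_mem Lsx x'E|sxN].
    have [Lsy sxy] := greenH_mull hL Lx xy Lsx.
    by rewrite (insubT [in L] (mem_set Lsy))/= x'E.
  case: insubP => //= y' /set_mem Lsy _.
  have [Lsx _] := greenH_mull hL Ly (greenH_sym xy) Lsy.
  by rewrite (mem_set Lsx) in sxN.
Qed.

Definition Hbar : Cong Lbar := MkCong Hbar_subproof.

End LclassAct.

Section Schutzenberger.
Variables (S : semigroupType) (H : set S) (hH : is_Hclass H).

(* The condition that H t is included in H is carried by the type H -> H. *)
Definition schutz_maps : set (H -> H) := [set f |
  exists2 t, S1 t & forall x : H, val (f x) = rmul1 (val x) t].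

(* The proof argument lets the group instance below be found by unification. *)
Definition schutz (_ : is_Hclass H) : Type := set_type schutz_maps.
Local Notation Gamma := (schutz hH).
HB.instance Definition _ := SubChoice.on Gamma.

Lemma schutz_id_subproof : schutz_maps id.
Proof.
have [[e eP]|nid] := pselect (has_identity S); last by exists None.
by exists (Some e) => //= x; case: (eP (val x)).
Qed.

Lemma schutz_comp_subproof (f g : H -> H) :
  schutz_maps f -> schutz_maps g -> schutz_maps (f \o g).
Proof.
move=> [t t1 ft] [u u1 gu]; case: t u t1 u1 ft gu => [t|] [u|] t1 u1 ft gu.
- by exists (Some (u * t)) => //= x; rewrite ft gu/= mulgA.
- by exists (Some t) => //= x; rewrite ft gu.
- by exists (Some u) => //= x; rewrite ft gu.
- by exists None => //= x; rewrite ft gu.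
Qed.

Lemma schutz_inv_subproof (f : H -> H) : schutz_maps f ->
  exists2 g, schutz_maps g & cancel f g /\ cancel g f.
Proof.
move=> [t _ ft]; have [h hE] := hH.
have Hh : H h by rewrite hE.
pose h' : H := SigSub (mem_set Hh).
have Hht : H (rmul1 h t) by have := set_mem (valP (f h')); rewrite ft.
have [hhtL hhtR] := (greenH_in _ hH Hh).1 Hht.
have [u u1 htu] := ((greenRP _ _).1 hhtR).2.
have ytu (y : H) : rmul1 (rmul1 (val y) t) u = val y.
  have [/greenLP[[v _ <-] _] _] := (greenH_in _ hH Hh).1 (set_mem (valP y)).
  by rewrite !lmul1_rmul1 htu.
have yut (y : H) : rmul1 (rmul1 (val y) u) t = val y.
  have [/greenLP[[v _ <-] _] _] := (greenH_in _ hH Hht).1 (set_mem (valP y)).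
  by rewrite !lmul1_rmul1 htu.
have Hu (y : H) : H (rmul1 (val y) u).
  have Hy := set_mem (valP y); apply/(greenH_in _ hH Hy); split.
    have [htyL _] := (greenH_in _ hH Hht).1 Hy.
    by have := greenL_mulr u htyL; rewrite htu /greenL => <-; rewrite hhtL.
  apply/greenRP; split; first exact: rideal_rmul1.
  by rewrite -{2}(yut y); exact: rideal_rmul1.
exists (fun y => SigSub (mem_set (Hu y))); first by exists u.
by split=> y; apply/val_inj; rewrite /= ?ft/= ?yut//; exact: ytu.
Qed.

Definition schutz_one : Gamma := SigSub (mem_set schutz_id_subproof).

Definition schutz_mul (f g : Gamma) : Gamma :=
  SigSub (mem_set (schutz_comp_subproof (set_mem (valP f)) (set_mem (valP g)))).

Definition schutz_inv (f : Gamma) : Gamma :=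
  let e := cid2 (schutz_inv_subproof (set_mem (valP f))) in
  SigSub (mem_set (s2valP e)).

Lemma schutz_mulA : associative schutz_mul.
Proof. by move=> f g h; exact/val_inj. Qed.

Lemma schutz_mul1 : left_id schutz_one schutz_mul.
Proof. by move=> f; exact/val_inj. Qed.

Lemma schutz_1mul : right_id schutz_one schutz_mul.
Proof. by move=> f; exact/val_inj. Qed.

Lemma schutz_mulV : left_inverse schutz_one schutz_inv schutz_mul.
Proof.
move=> f; apply/val_inj; rewrite /schutz_mul/schutz_inv/=.
by case: cid2 => g _ [fK gK] /=; apply/funext => x /=; exact: fK.
Qed.

Lemma schutz_Vmul : right_inverse schutz_one schutz_inv schutz_mul.
Proof.
move=> f; apply/val_inj; rewrite /schutz_mul/schutz_inv/=.
by case: cid2 => g _ [fK gK] /=; apply/funext => x /=; exact: gK.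
Qed.

HB.instance Definition _ := isGroup.Build Gamma
  schutz_mulA schutz_mul1 schutz_1mul schutz_mulV schutz_Vmul.

End Schutzenberger.

Definition is_subgroup (G : groupType) (K : set G) :=
  [/\ K 1, forall x y, K x -> K y -> K (x * y) & forall x, K x -> K x^-1].

(* The order is inclusion, inherited from set G. *)
Definition Subgroups (G : groupType) : Type := set_type (@is_subgroup G).
HB.instance Definition _ (G : groupType) := SubChoice.on (Subgroups G).
HB.instance Definition _ (G : groupType) :=
  [SubChoice_isSubPOrder of Subgroups G by <: with set_display].

(* None is the new top element. *)
Definition with_top (P : Type) : Type := option P.

Section WithTop.
Context d (P : porderType d).

HB.instance Definition _ := Choice.on (with_top P).

Definition wt_le (x y : with_top P) : bool :=
  match x, y with
  | _, None => true
  | Some a, Some b => (a <= b)%O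
  | None, Some _ => false
  end.

Lemma wt_le_refl : reflexive wt_le.
Proof. by case=> //= x. Qed.

Lemma wt_le_anti : antisymmetric wt_le.
Proof. by move=> [x|] [y|] //= /le_anti ->. Qed.

Lemma wt_le_trans : transitive wt_le.
Proof. by move=> [y|] [x|] [z|] //=; exact: le_trans. Qed.

HB.instance Definition _ :=
  Order.Le_isPOrder.Build d (with_top P) wt_le_refl wt_le_anti wt_le_trans.

End WithTop.

Definition order_iso d (P : porderType d) d' (Q : porderType d') :=
  exists2 f : P -> Q, bijective f & {mono f : x y / (x <= y)%O}.

Definition is_chain d (P : porderType d) (C : set P) :=
  total_on C (fun x y => (x <= y)%O).

(* Cardinals are represented by types, up to bijection: |K| is the supremum of
   the cardinalities of the chains in P.  Then option K represents |K| + 1. *)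
Definition is_height d (P : porderType d) (K : Type) :=
  (forall C : set P, is_chain C -> C #<= [set: K]) /\
  (forall K' : Type, (forall C : set P, is_chain C -> C #<= [set: K']) ->
    [set: K] #<= [set: K']).

(* Main.v *)
Require Import Defs.
From HB Require Import structures.
From mathcomp Require Import all_boot all_order.
From mathcomp Require Import all_classical.

(** Why the theorem holds.

    The three conditions.  Write A for the act on L with zero 0.  Congruences
    of A/H are congruences of A above H ([congruence_free_quotP]), so (i) and
    the maximality of H both say that nothing lies strictly between H and the
    top.  The syntactic congruence of {0}, the coarsest congruence for which
    {0} is a union of classes, is proper and lies above H, since H-related
    elements of L are sent out of L by the same s.  If nothing lies strictly
    between, it therefore equals H, and unfolding its definition gives (iii)
    ([above_Hbar_separates]).  Conversely, if (iii) holds and a congruence r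
    contains a pair outside H, then, after multiplication by a suitable s if
    necessary, it relates some element of L to 0; as L is a single L-class, every element is
    then related to 0 and r is the top.  So each congruence is below H or is the
    top ([cong_dichotomy]); uniqueness of the maximal congruence, the equality
    Cong(A) = [bot, H] + {top} and (i) all follow.

    The interval below H.  Fix an H-class H0 in L with its group Gamma of right
    translations.  Right translations commute with left multiplications, Gamma
    acts freely and transitively on H0, and each element of L is a left
    multiple of each point of H0.  Hence a congruence r below H is determined by
    the pairs (z, f z) with z in H0 and f in Gamma that it contains, and for
    fixed f this membership does not depend on z.  The f for which it holds
    form a subgroup, from which r is recovered as the set of all
    (v z, v (f z)); this is [subgroup_congK] and [cong_subgroupK].

    Heights.  The supremum of the cardinals of the chains is represented by a
    type; it exists because any nonempty family of types has a member that
    embeds in all the others ([embeds_min]), applied to the subsets of the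
    poset which bound all its chains.  Adjoining a top adds one point to the
    supremum: a bound for the chains of the extended poset, less one point,
    bounds the chains of the original one. *)

Set Implicit Arguments.
Unset Strict Implicit.
Unset Printing Implicit Defensive.

Import Order.TTheory.
Local Open Scope group_scope.
Local Open Scope classical_set_scope.
Local Open Scope card_scope.

(** * Comparing cardinals *)

Definition embeds (X Y : Type) := exists f : X -> Y, injective f.

Lemma embeds_trans X Y Z : embeds X Y -> embeds Y Z -> embeds X Z.
Proof. by move=> [f fI] [g gI]; exists (g \o f); exact: inj_comp. Qed.

Lemma card_leE T U (A : set T) (B : set U) : A #<= B <-> embeds A B.
Proof.
split=> [/card_leP[f]|[f fI]].
  by exists f => x y; apply: (@inj _ _ _ f); exact/mem_set.
apply/card_leP/injfunPex; exists f; first by [].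
by move=> x y _ _; exact: fI.
Qed.

Lemma embeds_setT T : embeds [set: T] T /\ embeds T [set: T].
Proof.
split; first by exists val; exact: val_inj.
exists (fun x => SigSub (mem_set (I : [set: T] x))) => x y.
by move/(congr1 val).
Qed.

Lemma card_le_setTE T U (A : set T) : A #<= [set: U] <-> embeds A U.
Proof.
rewrite card_leE; have [h h'] := embeds_setT U.
by split=> /embeds_trans; apply.
Qed.

Lemma card_setT_leE T U : [set: T] #<= [set: U] <-> embeds T U.
Proof.
rewrite card_le_setTE; have [h h'] := embeds_setT T.
by split; exact: embeds_trans.
Qed.

(** Take a set M of choice functions, maximal for the property that two members
    agreeing at one index are equal.  If every coordinate missed a value on M,
    the choice function picking missed values could be added.  So some
    coordinate i maps M bijectively onto X i, and the other coordinates embed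
    M.  With I = bool this is the comparability of cardinals; in general it says
    that cardinals are well-founded. *)
Lemma embeds_min (I : Type) (X : I -> Type) :
  I -> exists i, forall j, embeds (X i) (X j).
Proof.
move=> i0.
pose separated (M : set (forall i, X i)) :=
  forall i x y, M x -> M y -> x i = y i -> x = y.
have [F sepF totF|M [sepM maxM]] := @Zorn_bigcup _ separated.
  move=> i x y [A FA Ax] [B FB By].
  have [AB|BA] := totF _ _ FA FB; first exact: (sepF _ FB) (AB _ Ax) By.
  exact: (sepF _ FA) Ax (BA _ By).
have [i surj_i] : exists i, forall x : X i, exists2 m, M m & m i = x.
  apply: contrapT => noi.
  have missed i : exists x : X i, forall m, M m -> m i <> x.
    apply: contrapT => nox; apply: noi; exists i => x.
    apply: contrapT => nom; apply: nox; exists x => m Mm mx.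
    by apply: nom; exists m.
  pose m0 i := sval (cid (missed i)).
  have m0P i m : M m -> m i <> m0 i by exact: svalP (cid (missed i)) m.
  apply: (maxM (M `|` [set m0])).
    split; first by move=> m Mm; left.
    by move=> /(_ m0 (or_intror erefl)) /(m0P i0); apply.
  move=> i x y [Mx|->] [My|->] // e; first exact: sepM e.
    by have := m0P i x Mx.
  by have := m0P i y My; rewrite e.
pose g x := s2val (cid2 (surj_i x)).
have gM x : M (g x) by rewrite /g; case: cid2.
have gK x : g x i = x by rewrite /g; case: cid2.
exists i => j; exists (fun x => g x j) => x y /(sepM _ _ _ (gM x) (gM y)) e.
by rewrite -(gK x) e gK.
Qed.

(** * Heights *)

(** Only the subsets D of P compete in the minimization.  An arbitrary bound K'
    is compared with the minimal D: either D embeds in K', or K' is equipotent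
    to a subset of D, which then competes as well. *)
Lemma height_exists d (P : porderType d) : exists K : Type, is_height P K.
Proof.
pose bound (D : set P) := forall C : set P, is_chain C -> embeds C D.
have boundT : bound [set: P].
  by move=> C _; apply/card_leE; exact: card_leT.
have [[D Dbound] Dmin] :=
  @embeds_min {D | bound D} (fun D => set_type (sval D)) (exist _ _ boundT).
exists D; split=> [C /Dbound|K' K'bound]; first by rewrite card_le_setTE.
rewrite card_setT_leE.
have [[] /= minK'] := @embeds_min bool (fun b => if b then set_type D else K') true.
  exact: (minK' false).
have [f fI] := minK' true.
(* K' embeds in D; its image D' is a subset of P equipotent to K'. *)
pose D' := [set val (f k) | k in [set: K']].
have emK' : embeds K' D'.
  exists (fun k => SigSub (mem_set (imageP (val \o f) (I : [set: K'] k)))).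
  by move=> k l e; apply/fI/val_inj; exact: (congr1 val e).
have emD' : embeds D' K'.
  have D'P (x : D') : exists k, val (f k) = val x.
    by have [k _ <-] := set_mem (valP x); exists k.
  exists (fun x => sval (cid (D'P x))) => x y e; apply: val_inj.
  by rewrite -(svalP (cid (D'P x))) e (svalP (cid (D'P y))).
have D'bound : bound D'.
  by move=> C /K'bound/card_le_setTE/embeds_trans; apply.
exact: embeds_trans (Dmin (exist _ _ D'bound)) emD'.
Qed.

Lemma is_height_iso d (P : porderType d) d' (Q : porderType d') K :
  order_iso P Q -> is_height Q K -> is_height P K.
Proof.
move=> [f [g fK gK] fmono] [ub lub].
have gmono : {mono g : x y / (x <= y)%O} by move=> x y; rewrite -fmono !gK.
have fI := can_inj fK; have gI := can_inj gK.
split=> [C chC|K' K'bound].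
  rewrite -(card_le_eql (inj_card_eq (in2W fI))).
  apply: ub => _ _ [x Cx <-] [y Cy <-]; rewrite !fmono; exact: chC.
apply: lub => C chC.
rewrite -(card_le_eql (inj_card_eq (in2W gI))).
apply: K'bound => _ _ [x Cx <-] [y Cy <-]; rewrite !gmono; exact: chC.
Qed.

(** From right to left, y0 may be a value of the embedding f; the point of X that
    is sent to y0 is then rerouted to the value f None. *)
Lemma embeds_option (X Y : Type) (y0 : Y) :
  embeds X {y | y <> y0} <-> embeds (option X) Y.
Proof.
split=> [[f fI]|[f fI]].
  exists (fun o => if o is Some x then sval (f x) else y0).
  move=> [x|] [y|] //= e; first by congr Some; apply: fI; apply: eq_sig_hprop e => ? ? ?; exact: Prop_irrelevance.
    by have := svalP (f x); rewrite e.
  by have := svalP (f y); rewrite -e.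
pose h x := if pselect (f (Some x) = y0) then f None else f (Some x).
have hP x : h x <> y0.
  by rewrite /h; case: pselect => // e e'; have := fI _ _ (etrans e (esym e')).
exists (fun x => exist _ (h x) (hP x)) => x y /(congr1 sval) /=.
rewrite /h; case: pselect => [ex|nx]; case: pselect => [ey|ny] e.
- by have /fI[] := etrans ex (esym ey).
- by have := fI _ _ e.
- by have := fI _ _ e.
- by have [] := fI _ _ e.
Qed.

(** If K' bounds the chains of the extended poset and C is a chain of P, then
    option C embeds in K', so C embeds in K' less a point.  Hence K embeds there
    too, whether the height is finite or infinite. *)
Lemma is_height_with_top d (P : porderType d) K :
  is_height P K -> is_height (with_top P) (option K).
Proof.
move=> [ub lub]; split=> [C chC|K' K'bound].
  apply/card_le_setTE; pose C0 : set P := [set x | C (Some x)].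
  have /ub/card_le_setTE[f fI] : is_chain C0.
    by move=> x y Cx Cy; exact: (chC _ _ Cx Cy).
  pose g (c : C) : option K :=
    (match val c as o return C o -> option K with
    | Some x => fun Cx => Some (f (SigSub (mem_set (Cx : C0 x))))
    | None => fun _ => None
    end) (set_mem (valP c)).
  exists g => -[[x|] Cx] [[y|] Cy]; rewrite /g//=; last by move=> _; exact: val_inj.
  by move=> [/fI/(congr1 val)/= exy]; apply: val_inj; rewrite /= exy.
have /K'bound/card_le_setTE[j _] : is_chain [set (None : with_top P)].
  by move=> _ _ -> ->; left.
(* The one-element chain {top} provides a point of K' to remove. *)
pose k0 := j (SigSub (mem_set (erefl : [set (None : with_top P)] None))).
apply/card_setT_leE/(embeds_option _ k0)/card_setT_leE/lub => C chC.
apply/card_le_setTE/embeds_option.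
pose CT : set (with_top P) := [set o | if o is Some x then C x else True].
have /K'bound/card_le_setTE : is_chain CT.
  by move=> [x|] [y|] //= Cx Cy; [exact: chC|left|right|left].
apply: embeds_trans.
pose s (o : option C) : with_top P := omap val o.
have sCT o : CT (s o) by case: o => //= x; exact: set_mem (valP x).
exists (fun o => SigSub (mem_set (sCT o))) => -[x|] [y|] e //; have := congr1 val e => //= -[xy].
by congr Some; exact: val_inj.
Qed.

(** * Syntactic congruences *)

Section CongruenceOrder.
Variables (S : semigroupType) (A : lact S).
Implicit Types r t : Cong A.

Lemma cong_leP r t :
  (r <= t)%O <-> forall a b, cong_rel r (a, b) -> cong_rel t (a, b).
Proof.
rewrite -Order.le_val subsetEset.
by split=> [rt a b|rt [a b]]; exact: rt.
Qed.

Lemma cong_bot_le r : (cong_bot A <= r)%O.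
Proof. by apply/cong_leP => a b e; have -> : a = b := e; exact: cong_refl (congP r) b. Qed.

Lemma cong_topP r : r = cong_top A <-> forall a b, cong_rel r (a, b).
Proof.
split=> [-> //|rT].
by apply/le_anti/andP; split; apply/cong_leP => a b _ //; exact: rT.
Qed.

(** The coarsest congruence for which {z} is a union of classes.  The first
    clause is the action of the identity of S^1. *)
Definition syntactic_set (z : A) : set (A * A) := [set p |
  (p.1 = z <-> p.2 = z) /\
  forall s, lact_op s p.1 = z <-> lact_op s p.2 = z].

Lemma syntactic_subproof z : is_congruence (syntactic_set z).
Proof.
split=> [//|a b|b a c|s a b] /=.
- by move=> [ab sab]; split=> [|s]; apply: iff_sym.
- move=> [ab sab] [bc sbc]; split=> [|s]; first exact: iff_trans ab bc.
  exact: iff_trans (sab s) (sbc s).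
- by move=> [_ sab]; split=> [|s']; rewrite ?lact_opA; exact: sab.
Qed.

Definition syntactic_cong z : Cong A := MkCong (syntactic_subproof z).

End CongruenceOrder.

(** * Congruences of a quotient act *)

Section QuotientCongruences.
Variables (S : semigroupType) (A : lact S) (r : Cong A).
Local Notation Q := (quot_act r).
Local Notation cls := (\pi_{eq_quot (cong_equiv_rel r)}%qT : A -> Q).

Lemma quot_eqP (a b : A) : cls a = cls b <-> cong_rel r (a, b).
Proof. by split=> [/eqmodP/asboolP|/asboolP ab]; last exact/eqmodP. Qed.

Lemma cls_op s (a : A) : lact_op s (cls a) = cls (lact_op s a).
Proof. exact: quot_op_pi. Qed.

Lemma cls_repr (X : Q) : exists a, X = cls a.
Proof. by exists (repr X); rewrite reprK. Qed.

Lemma pullback_subproof (q : Cong Q) :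
  is_congruence [set p : A * A | cong_rel q (cls p.1, cls p.2)].
Proof.
have [rf sy tr op] := congP q.
split=> [a|a b|b a c|s a b] /=; [exact: rf|exact: sy|exact: tr|].
by rewrite -!cls_op; exact: op.
Qed.

(** That r is below t matters for transitivity: the two middle representatives
    are only r-related. *)
Lemma image_subproof (t : Cong A) : (r <= t)%O ->
  is_congruence [set p : Q * Q |
    exists a b, [/\ p.1 = cls a, p.2 = cls b & cong_rel t (a, b)]].
Proof.
move=> /cong_leP rt; have [rf sy tr op] := congP t.
split=> [X|X Y|Y X Z|s X Y] /=.
- by have [a ->] := cls_repr X; exists a, a.
- by move=> [a [b [-> -> /sy ba]]]; exists b, a.
- move=> [a [b [-> -> ab]]] [b' [c [/quot_eqP/rt bb' -> b'c]]].
  by exists a, c; split=> //; exact: tr (tr _ _ _ ab bb') b'c.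
- move=> [a [b [-> -> ab]]]; exists (lact_op s a), (lact_op s b).
  by split; [exact: cls_op|exact: cls_op|exact: op].
Qed.

(** The correspondence theorem: taking images and preimages along the quotient
    map matches the congruences of A/r with those of A above r. *)
Lemma congruence_free_quotP :
  congruence_free Q <-> forall t, (r <= t)%O -> t = r \/ t = cong_top A.
Proof.
split=> [cf t rt|above q].
  have [e|e] := cf (MkCong (image_subproof rt)); [left|right].
    apply/le_anti; rewrite rt andbT; apply/cong_leP => a b ab; apply/quot_eqP.
    have : cong_rel (MkCong (image_subproof rt)) (cls a, cls b) by exists a, b.
    by rewrite e.
  apply/cong_topP => a b; move/cong_topP: e => /(_ (cls a) (cls b)).
  move=> [a' [b' [/quot_eqP aa' /quot_eqP bb' a'b']]].
  have [_ sy tr _] := congP t; move/cong_leP: rt => rt.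
  exact: tr (tr _ _ _ (rt _ _ aa') a'b') (sy _ _ (rt _ _ bb')).
have rq : (r <= MkCong (pullback_subproof q))%O.
  apply/cong_leP => a b /quot_eqP e.
  have : cong_rel q (cls b, cls b) by exact: cong_refl (congP q) _.
  by rewrite -{1}e.
have [e|/cong_topP e] := above _ rq; [left|right].
  apply/le_anti; rewrite cong_bot_le andbT; apply/cong_leP => X Y.
  have [[a ->] [b ->]] := (cls_repr X, cls_repr Y).
  move=> ab; apply/quot_eqP; rewrite -e; exact: ab.
apply/cong_topP => X Y; have [[a ->] [b ->]] := (cls_repr X, cls_repr Y).
exact: e.
Qed.

End QuotientCongruences.

(** * Congruences of the act on an L-class *)

Section LclassCongruences.
Variables (S : semigroupType) (L : set S) (hL : is_Lclass L).
Implicit Types (x y : L) (v : option S) (r t : Cong (Lbar hL)).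

Lemma Lclass_mem x : L (val x). Proof. exact: set_mem (valP x). Qed.

Definition Lelt (a : S) (La : L a) : L := SigSub (mem_set La).

Lemma Lbar_op_in s x y : val y = s * val x ->
  lact_op s (Some x : Lbar hL) = Some y.
Proof.
move=> e; rewrite /= /Lbar_op /= -e; exact: valK.
Qed.

Lemma Lbar_op_notin s x : ~ L (s * val x) -> lact_op s (Some x : Lbar hL) = None.
Proof. by move=> n; rewrite /= /Lbar_op /= insubN //; apply/negP => /set_mem. Qed.

Lemma Lclass_lmul1 x y : exists v, val y = lmul1 v (val x).
Proof.
have /greenLP[/= [v _ <-] _] := (greenL_in _ hL (Lclass_mem x)).1 (Lclass_mem y).
by exists v.
Qed.

Lemma cong_lmul1 r v x y x' y' : cong_rel r (Some x, Some y) ->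
  val x' = lmul1 v (val x) -> val y' = lmul1 v (val y) ->
  cong_rel r (Some x', Some y').
Proof.
case: v => [s|] xy ex ey; last first.
  have -> : x' = x by exact: val_inj.
  by have -> : y' = y by exact: val_inj.
by rewrite -(Lbar_op_in ex) -(Lbar_op_in ey); exact: (cong_op (congP r)).
Qed.

(** Every element of L is a left multiple of x, and 0 is fixed, so all of L is
    related to 0. *)
Lemma cong_zero_top r x : cong_rel r (Some x, None) -> r = cong_top (Lbar hL).
Proof.
have [rf sy tr op] := congP r.
move=> x0; have all0 (a : Lbar hL) : cong_rel r (a, None).
  case: a => [y|//]; have [[s|] e] := Lclass_lmul1 x y; last first.
    by have -> : y = x by exact: val_inj.
  by rewrite -(Lbar_op_in e); exact: op s _ _ x0.
by apply/cong_topP => a b; exact: tr (all0 a) (sy _ _ (all0 b)).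
Qed.

Lemma Hbar_neq_top : Hbar hL <> cong_top (Lbar hL).
Proof.
have [a LE] := hL; have La : L a by rewrite LE.
by move/cong_topP => /(_ (Some (Lelt La)) None).
Qed.

(** Condition (iii): the multipliers that keep an element of L inside L determine
    its H-class. *)
Definition separates_Hclasses := forall x y : S, L x -> L y -> ~ greenH x y ->
  exists s : S, (L (s * x) /\ ~ L (s * y)) \/ (~ L (s * x) /\ L (s * y)).

(** A pair of r outside H either joins an element of L to 0 already or becomes
    such a pair under a separating s, and such a pair generates the top. *)
Lemma cong_dichotomy r : separates_Hclasses ->
  (r <= Hbar hL)%O \/ r = cong_top (Lbar hL).
Proof.
move=> sepL; have [rf sy tr op] := congP r.
have [rT|nrT] := pselect (r = cong_top (Lbar hL)); [by right|left].
apply/cong_leP => -[x|] [y|] //= xy.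
- apply: contrapT => nxy; apply: nrT.
  have [s [[Lsx nLsy]|[nLsx Lsy]]] := sepL _ _ (Lclass_mem x) (Lclass_mem y) nxy.
    apply: (@cong_zero_top _ (Lelt Lsx)); rewrite -(Lbar_op_notin nLsy).
    by rewrite -(@Lbar_op_in s x)//; exact: op.
  apply: (@cong_zero_top _ (Lelt Lsy)); rewrite -(Lbar_op_notin nLsx).
  by rewrite -(@Lbar_op_in s y)//; apply: sy; exact: op.
- by apply: nrT; exact: cong_zero_top xy.
- by apply: nrT; exact: cong_zero_top (sy _ _ xy).
Qed.

(** H is a congruence with {0} as one of its classes. *)
Lemma Hbar_le_syntactic : (Hbar hL <= @syntactic_cong _ (Lbar hL) None)%O.
Proof.
apply/cong_leP => a b ab; have h0 (c d : Lbar hL) :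
    cong_rel (Hbar hL) (c, d) -> c = None <-> d = None.
  by case: c d => [c|] [d|].
by split=> [|s]; apply: h0 => //; exact: (cong_op (congP (Hbar hL))).
Qed.

(** The syntactic congruence of {0} relates exactly the pairs of L which no s
    separates.  It does not relate L to 0, so it is not the top and must be H. *)
Lemma above_Hbar_separates :
  (forall t, (Hbar hL <= t)%O -> t = Hbar hL \/ t = cong_top (Lbar hL)) ->
  separates_Hclasses.
Proof.
move=> above x y Lx Ly nxy; apply: contrapT => nos.
have [e|/cong_topP e] := above _ Hbar_le_syntactic; last first.
  by have [/= [_ /(_ erefl)]] := e (Some (Lelt Lx)) None.
apply: nxy; suff : cong_rel (Hbar hL) (Some (Lelt Lx), Some (Lelt Ly)) by [].
rewrite -e; split=> [//|s].
have [Lsx|nLsx] := pselect (L (s * x)); have [Lsy|nLsy] := pselect (L (s * y)).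
- rewrite (@Lbar_op_in s (Lelt Lx) (Lelt Lsx))//.
  by rewrite (@Lbar_op_in s (Lelt Ly) (Lelt Lsy)).
- by case: nos; exists s; left.
- by case: nos; exists s; right.
- by rewrite (@Lbar_op_notin s (Lelt Lx))// (@Lbar_op_notin s (Lelt Ly)).
Qed.

Lemma maximal_HbarP :
  maximal_cong (Hbar hL) <->
  forall t, (Hbar hL <= t)%O -> t = Hbar hL \/ t = cong_top (Lbar hL).
Proof.
have leT t : (t <= cong_top (Lbar hL))%O by apply/cong_leP.
split=> [[_ maxH] t Ht|above].
  have [->|/eqP ntH] := pselect (t = Hbar hL); first by left.
  right; apply: contrapT => /eqP ntT; apply: maxH; exists t.
  by rewrite !lt_neqAle Ht leT ntT eq_sym ntH.
split; first exact: Hbar_neq_top.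
move=> [t /andP[Ht tT]]; have [e|e] := above _ (ltW Ht).
  by rewrite e ltxx in Ht.
by rewrite e ltxx in tT.
Qed.

End LclassCongruences.

(** * Congruences below H and subgroups of the group of translations *)

Section SchutzenbergerCorrespondence.
Variables (S : semigroupType) (L : set S) (hL : is_Lclass L).
Variables (H : set S) (hH : is_Hclass H) (HL : H `<=` L).
Local Notation Gamma := (schutz hH).
Implicit Types (z : H) (v w : option S) (f g : Gamma).

Lemma Hclass_mem z : H (val z). Proof. exact: set_mem (valP z). Qed.

Definition Hclass_in_Lclass z : L := Lelt (HL (Hclass_mem z)).
Local Notation iota := Hclass_in_Lclass.

Lemma Hclass_inhabited : exists z : H, True.
Proof.
have [h HE] := hH; have Hh : H h by rewrite HE.
by exists (SigSub (mem_set Hh)).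
Qed.

(** Right translations commute with left multiplications.  Two multipliers v and
    w are allowed because an element of L can be written in several ways as a
    left multiple of a point of H. *)
Lemma schutz_equivariant f v w z z' :
  lmul1 v (val z) = lmul1 w (val z') ->
  lmul1 v (val (val f z)) = lmul1 w (val (val f z')).
Proof.
have [t _ ft] := set_mem (valP f).
by move=> e; rewrite !ft -!lmul1_rmul1 e.
Qed.

(** Any point of H is a left multiple of z, so the value at z determines a
    translation. *)
Lemma schutz_free f g z : val f z = val g z -> f = g.
Proof.
move=> e; apply/val_inj/funext => z'; apply/val_inj.
have [v ev] := Lclass_lmul1 hL (iota z) (iota z').
have eqv (k : Gamma) : val (val k z') = lmul1 v (val (val k z)).
  exact: (@schutz_equivariant k None v z' z ev).
by rewrite [LHS]eqv e -eqv.
Qed.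

Lemma lmul1_greenH v (a b : S) :
  L a -> greenH a b -> L (lmul1 v a) -> greenH (lmul1 v a) (lmul1 v b).
Proof. by case: v => [s|//] La ab Lsa; have [] := greenH_mull hL La ab Lsa. Qed.

(** A translation that sends one point of H into H maps all of H into H:
    writing u = v z gives u t = v (z t), which is H-related to v z = u. *)
Lemma schutz_translation z z' t : S1 t -> rmul1 (val z) t = val z' ->
  exists f, forall u : H, val (val f u) = rmul1 (val u) t.
Proof.
move=> t1 zt.
have Hut (u : H) : H (rmul1 (val u) t).
  have [v ev] := Lclass_lmul1 hL (iota z) (iota u).
  apply/(greenH_in _ hH (Hclass_mem u)).
  rewrite [val u]ev lmul1_rmul1 /= zt; apply: lmul1_greenH.
  - exact: HL (Hclass_mem z).
  - exact/(greenH_in _ hH (Hclass_mem z))/Hclass_mem.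
  - by rewrite -[lmul1 _ _]ev; exact: Lclass_mem.
have fP : schutz_maps (fun u : H => SigSub (mem_set (Hut u)) : H) by exists t.
by exists (SigSub (mem_set fP)).
Qed.

Section SubgroupOfCongruence.
Variable r : Cong (Lbar hL).

Definition schutz_stab : set Gamma :=
  [set f | forall z, cong_rel r (Some (iota z), Some (iota (val f z)))].

Lemma schutz_stab_subgroup : is_subgroup schutz_stab.
Proof.
have [rf sy tr op] := congP r.
split=> [z|f g Kf Kg z|f Kf z] /=; first exact: rf.
  exact: tr (Kg z) (Kf (val g z)).
have e : val f (val f^-1 z) = z.
  by have /(congr1 (fun k : Gamma => val k z)) := mulgV f.
by have := sy _ _ (Kf (val f^-1 z)); rewrite e.
Qed.

End SubgroupOfCongruence.

Definition cong_subgroup r : Subgroups Gamma :=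
  SigSub (mem_set (schutz_stab_subgroup r)).

Section CongruenceOfSubgroup.
Variable K : Subgroups Gamma.

(** The orbit relation of K, spread from H to the whole of L by left
    multiplications. *)
Definition translates (a b : S) := exists v z f,
  [/\ val K f, a = lmul1 v (val z) & b = lmul1 v (val (val f z))].

(** z and f z are H-related, and left multiplications which keep z in L preserve
    the relation. *)
Lemma translates_greenH a b : L a -> translates a b -> greenH a b.
Proof.
move=> La [v [z [f [_ ea ->]]]]; rewrite ea in La *.
apply: lmul1_greenH => //; first exact: HL (Hclass_mem z).
exact/(greenH_in _ hH (Hclass_mem z))/Hclass_mem.
Qed.

Lemma translates_mull s a b : translates a b -> translates (s * a) (s * b).
Proof.
move=> [v [z [f [Kf -> ->]]]].
exists (Some (if v is Some u then s * u else s)), z, f.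
by case: v => [u|] /=; rewrite ?mulgA.
Qed.

(** Transitivity is where the independence of the multiplier is used: if
    v (f z) = w z', then w (g z') = v (g (f z)). *)
Lemma translates_equiv : [/\ forall x : L, translates (val x) (val x),
  forall a b, translates a b -> translates b a &
  forall b a c, translates a b -> translates b c -> translates a c].
Proof.
have [K1 KM KV] := set_mem (valP K); have [z0 _] := Hclass_inhabited.
split.
- by move=> x; have [v e] := Lclass_lmul1 hL (iota z0) x; exists v, z0, 1.
- move=> a b [v [z [f [Kf -> ->]]]].
  exists v, (val f z), f^-1; split=> //; first exact: KV.
  by have /(congr1 (fun k : Gamma => val k z)) /= -> := mulVg f.
- move=> b a c [v [z [f [Kf -> ->]]]] [w [z' [g [Kg e ->]]]].
  exists v, z, (g * f); split=> //; first exact: KM.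
  by rewrite -(schutz_equivariant g e).
Qed.

Definition subgroup_cong_set : set (Lbar hL * Lbar hL) := [set p |
  match p with
  | (Some x, Some y) => translates (val x) (val y)
  | (None, None) => True
  | _ => False
  end].

Lemma subgroup_cong_subproof : is_congruence subgroup_cong_set.
Proof.
have [rf sy tr] := translates_equiv.
split.
- by case=> [x|] //=; exact: rf.
- by move=> [x|] [y|] //=; exact: sy.
- by move=> [y|] [x|] [z|] //=; exact: tr.
- move=> s [x|] [y|] // xy.
  have Hxy := translates_greenH (Lclass_mem x) xy.
  have [Lsx|nLsx] := pselect (L (s * val x)).
    have [Lsy _] := greenH_mull hL (Lclass_mem x) Hxy Lsx.
    rewrite (@Lbar_op_in _ _ hL s x (Lelt Lsx))//.
    rewrite (@Lbar_op_in _ _ hL s y (Lelt Lsy))//.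
    exact: translates_mull.
  rewrite Lbar_op_notin// Lbar_op_notin// => Lsy; apply: nLsx.
  by have [] := greenH_mull hL (Lclass_mem y) (greenH_sym Hxy) Lsy.
Qed.

Definition subgroup_cong : Cong (Lbar hL) := MkCong subgroup_cong_subproof.

Lemma subgroup_cong_le : (subgroup_cong <= Hbar hL)%O.
Proof.
apply/cong_leP => -[x|] [y|] //=; exact: translates_greenH (Lclass_mem x).
Qed.

End CongruenceOfSubgroup.

Lemma subgroup_leP (K K' : Subgroups Gamma) :
  (K <= K')%O <-> forall f, val K f -> val K' f.
Proof. by rewrite -Order.le_val subsetEset. Qed.

Lemma cong_subgroup_homo : {homo cong_subgroup : r t / (r <= t)%O}.
Proof.
move=> r t /cong_leP rt; apply/subgroup_leP => f Kf z; exact/rt/Kf.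
Qed.

Lemma subgroup_cong_homo : {homo subgroup_cong : K K' / (K <= K')%O}.
Proof.
move=> K K' /subgroup_leP KK'; apply/cong_leP => -[x|] [y|] //=.
by move=> [v [z [f [/KK' Kf ? ?]]]]; exists v, z, f.
Qed.

(** If f lies in the subgroup recovered from the congruence, then at some point
    it agrees with an element of K, and Gamma acts freely. *)
Lemma subgroup_congK : cancel subgroup_cong cong_subgroup.
Proof.
move=> K; apply/le_anti/andP; split; apply/subgroup_leP => f.
  have [z _] := Hclass_inhabited.
  move=> /(_ z) /= [v [z' [g [Kg e ef]]]].
  suff -> : f = g by [].
  apply: (@schutz_free _ _ z); apply/val_inj.
  by rewrite [LHS]ef -(@schutz_equivariant g None v z z' e).
by move=> Kf z; exists None, z, f.
Qed.

(** Given (x, y) in r, write x = v z0 and y = x t.  Translation by t preserves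
    the H-class of z0, and it is in the subgroup because each pair (z, z t) is
    a left multiple of (x, x t) = (x, y). *)
Lemma cong_subgroupK r : (r <= Hbar hL)%O -> subgroup_cong (cong_subgroup r) = r.
Proof.
move=> /cong_leP rH; have [rf sy tr op] := congP r.
apply/le_anti/andP; split; apply/cong_leP => -[x|] [y|] //=.
- by move=> [v [z [f [Kf ex ey]]]]; exact: cong_lmul1 (Kf z) ex ey.
- move=> xy; have [z0 _] := Hclass_inhabited.
  have [v ex] := Lclass_lmul1 hL (iota z0) x.
  have [w ez] := Lclass_lmul1 hL x (iota z0).
  have Hxy : greenH (val x) (val y) := rH _ _ xy.
  have [t t1 et] := ((greenRP _ _).1 Hxy.2).1.
  (* z0 t = w x t = w y is H-related to w x = z0. *)
  have Hz' : H (rmul1 (val z0) t).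
    apply/(greenH_in _ hH (Hclass_mem z0)).
    rewrite [val z0]ez lmul1_rmul1 et; apply: lmul1_greenH => //.
      exact: Lclass_mem.
    by rewrite -[lmul1 _ _]ez; exact: Lclass_mem.
  have [f ft] := @schutz_translation z0 (SigSub (mem_set Hz')) t t1 erefl.
  exists v, z0, f; split=> [z|//|]; last first.
    by rewrite ft -lmul1_rmul1 -[lmul1 _ _]ex et.
  have [u eu] := Lclass_lmul1 hL x (iota z).
  apply: (cong_lmul1 xy eu).
  by rewrite /= ft [val z]eu lmul1_rmul1 et.
- by move/rH.
- by move/rH.
Qed.

(** The dichotomy makes the two correspondences, extended by sending the top to
    the adjoined top, mutually inverse. *)
Lemma cong_Lbar_iso : separates_Hclasses L ->
  order_iso (Cong (Lbar hL)) (with_top (Subgroups Gamma)).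
Proof.
move=> sepL.
pose F r : with_top (Subgroups Gamma) :=
  if (r <= Hbar hL)%O then Some (cong_subgroup r) else None.
pose G (o : with_top (Subgroups Gamma)) :=
  if o is Some K then subgroup_cong K else cong_top (Lbar hL).
have topN : ~~ (cong_top (Lbar hL) <= Hbar hL)%O.
  apply/negP => /cong_leP le; apply: (@Hbar_neq_top _ _ hL).
  by apply/cong_topP => a b; exact: le.
have FK : cancel F G.
  move=> r; rewrite /F; have [rH|->] := cong_dichotomy r sepL.
    by rewrite rH /= cong_subgroupK.
  by rewrite (negPf topN).
have GK : cancel G F.
  by move=> [K|]; rewrite /F /= ?(negPf topN)// subgroup_cong_le subgroup_congK.
have Fhomo : {homo F : r t / (r <= t)%O}.
  move=> r t rt; rewrite /F; case: ifPn => [rH|nrH].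
    by case: ifP => // _; exact: cong_subgroup_homo.
  by case: ifPn => // tH; rewrite (le_trans rt tH) in nrH.
have Ghomo : {homo G : o p / (o <= p)%O}.
  move=> [K|] [K'|] //=; first exact: subgroup_cong_homo.
  by move=> _; apply/cong_leP.
exists F; first by exists G.
by move=> r t; apply/idP/idP => [/Ghomo|/Fhomo//]; rewrite !FK.
Qed.

End SchutzenbergerCorrespondence.

Theorem proposition7p4 (S : semigroupType) (L : set S) (hL : is_Lclass L) :
  [<-> congruence_free (quot_act (Hbar hL));
       maximal_cong (Hbar hL) /\
         (forall r : Cong (Lbar hL), maximal_cong r -> r = Hbar hL);
       forall x y : S, L x -> L y -> ~ greenH x y ->
         exists s : S, (L (s * x) /\ ~ L (s * y)) \/ (~ L (s * x) /\ L (s * y))]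
  /\
  (congruence_free (quot_act (Hbar hL)) ->
   [set: Cong (Lbar hL)] =
     [set r | (cong_bot (Lbar hL) <= r <= Hbar hL)%O] `|` [set cong_top (Lbar hL)]
   /\
   forall (H : set S) (hH : is_Hclass H), H `<=` L ->
     order_iso (Cong (Lbar hL)) (with_top (Subgroups (schutz hH)))
     /\
     exists K : Type, is_height (Subgroups (schutz hH)) K /\
       is_height (Cong (Lbar hL)) (option K)).
Proof.
have cfP := congruence_free_quotP (Hbar hL).
split.
  split=> [/cfP above|]; last split=> [[/maximal_HbarP above _]|sepL].
  - split=> [|r [nrT rmax]]; first exact/maximal_HbarP.
    have [rH|//] := cong_dichotomy r (above_Hbar_separates above).
    apply: contrapT => /eqP nrH; apply: rmax; exists (Hbar hL).
    rewrite !lt_neqAle rH nrH /=; apply/andP; split; last exact/cong_leP.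
    exact/eqP/Hbar_neq_top.
  - exact: above_Hbar_separates above.
  - apply/cfP => t Ht; have [tH|] := cong_dichotomy t sepL; last by right.
    by left; apply/le_anti; rewrite tH.
move=> /cfP/above_Hbar_separates sepL; split.
  apply/seteqP; split=> // r _.
  have [rH|] := cong_dichotomy r sepL; last by right.
  by left; rewrite /= cong_bot_le.
move=> H hH HL; have iso := cong_Lbar_iso hL hH HL sepL; split=> //.
have [K hK] := height_exists (Subgroups (schutz hH)).
by exists K; split=> //; exact/(is_height_iso iso)/is_height_with_top.
Qed.
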